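(* Let $M = \mathbb{R}^2$ and let $E \subseteq Vect(\mathbb{R}^2)$ be the locally free involutive $C^\infty(\mathbb{R}^2)$-submodule generated by $$v_1 = x\frac{\partial}{\partial x} + y\frac{\partial}{\partial y}, \qquad v_2 = -y\frac{\partial}{\partial x} + x\frac{\partial}{\partial y}.$$ Then $${^E}H^k(M) \cong \begin{cases} \mathbb{R} & k=0\\ \mathbb{R}^2 & k=1\\ \mathbb{R} & k=2\\ 0 & \text{otherwise.}\end{cases}$$
   Context: $Vect(M)$ is the $C^\infty(M)$-module of smooth vector fields on $M$. A locally free involutive submodule $E \subseteq Vect(M)$ determines a vector bundle ${^E}TM$ whose sections are the sections of $E$, with dual ${^E}T^*M$. $E$-forms of degree $p$ are the global sections of $\wedge^p({^E}T^*M)$; they form ${^E}\Omega^p(M)$. The differential is $$d\omega(V_0,\dots,V_p) = \sum_i (-1)^i V_i(\omega(V_0,\dots,\hat V_i,\dots,V_p)) + \sum_{i<j}(-1)^{i+j}\omega([V_i,V_j],V_0,\dots,\hat V_i,\dots,\hat V_j,\dots,V_p),$$ and ${^E}H^*(M)$ is the cohomology of the complex $({^E}\Omega^*(M), d)$. In the present case ${^E}T^*M$ is generated by the dual frame $v_1^* = \frac{x\,dx+y\,dy}{x^2+y^2}$, $v_2^* = \frac{-y\,dx+x\,dy}{x^2+y^2}$. *)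

(* Defs.v *)
From HB Require Import structures.
From mathcomp Require Import all_boot all_order all_algebra.
From mathcomp Require Import generic_quotient ring_quotient.
From mathcomp Require Import ring lra.
From mathcomp Require Import all_classical all_reals all_analysis.

Set Implicit Arguments.
Unset Strict Implicit.
Unset Printing Implicit Defensive.

Import Order.TTheory GRing.Theory Num.Theory.
Import numFieldTopology.Exports numFieldNormedType.Exports.

Local Open Scope classical_set_scope.
Local Open Scope ring_scope.

(* The quotient of a module by a submodule: Quotient.quot only carries the
   additive group structure. *)
Section LmodQuotient.
Variables (R : pzRingType) (V : lmodType R) (I : submodClosed V).
Local Open Scope quotient_scope.

Lemma submodClosed_zmod : zmod_closed (I : {pred V}).
Proof.
by split=> [|v w vI wI]; rewrite ?rpred0// rpredD// -scaleN1r rpredZ.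
Qed.

Definition submod_zmodClosed : zmodClosed V :=
  HB.pack (fun v : V => v \in I)
    (GRing.isZmodClosed.Build V (fun v => v \in I) submodClosed_zmod).

Definition lquot : Type := Quotient.quot submod_zmodClosed.
HB.instance Definition _ := GRing.Zmodule.on lquot.

Definition lclass (v : V) : lquot := \pi_(Quotient.quot submod_zmodClosed) v.

Lemma lclassP (v w : V) : lclass v = lclass w <-> v - w \in I.
Proof.
rewrite -[v - w \in I]/(v - w \in submod_zmodClosed) Quotient.idealrBE.
exact: (rwP eqP).
Qed.

Definition lrepr (q : lquot) : V := repr (q : Quotient.quot submod_zmodClosed).

Lemma lreprK : cancel lrepr lclass. Proof. exact: reprK. Qed.

Definition lscale (a : R) (q : lquot) : lquot := lclass (a *: lrepr q).

Lemma lclassD : {morph lclass : v w / v + w}.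
Proof. by move=> v w; rewrite /lclass raddfD. Qed.

Lemma lclassZ a v : lclass (a *: v) = lscale a (lclass v).
Proof. by apply/lclassP; rewrite -scalerBr rpredZ//; apply/lclassP; rewrite lreprK. Qed.

Lemma lscalerA a b q : lscale a (lscale b q) = lscale (a * b) q.
Proof. by rewrite -[q]lreprK -!lclassZ scalerA. Qed.

Lemma lscale1r : left_id 1 lscale.
Proof. by move=> q; rewrite -[q]lreprK -lclassZ scale1r. Qed.

Lemma lscalerDr : right_distributive lscale +%R.
Proof.
move=> a x y; rewrite -[x]lreprK -[y]lreprK.
by rewrite -lclassD -!lclassZ scalerDr lclassD.
Qed.

Lemma lscalerDl q : {morph lscale^~ q : a b / a + b}.
Proof.
by move=> a b; rewrite -[q]lreprK -!lclassZ scalerDl lclassD.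
Qed.

HB.instance Definition _ := GRing.Zmodule_isLmodule.Build R lquot
  lscalerA lscale1r lscalerDr lscalerDl.

Lemma lclass_linear : linear lclass.
Proof. by move=> a v w; rewrite lclassD lclassZ. Qed.
HB.instance Definition _ :=
  GRing.isLinear.Build R V lquot _ lclass lclass_linear.

End LmodQuotient.

Section SmoothFunctions.
Variables (R : realType) (n : nat).
Implicit Types (f g : 'rV[R]_n -> R) (s : seq 'I_n) (U : set 'rV[R]_n).

Definition partial (i : 'I_n) f : 'rV[R]_n -> R :=
  fun x => 'D_(delta_mx 0 i) f x.

Definition partials s f : 'rV[R]_n -> R := foldl (fun g i => partial i g) f s.

(* All iterated partial derivatives exist and are continuous at every point of
   U; meant for open U, the values of f outside U being irrelevant. *)
Definition smooth_on U f : Prop := forall s x, U x ->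
  {for x, continuous (partials s f)} /\
  (forall i, derivable (partials s f) x (delta_mx 0 i)).

Definition smooth f : Prop := smooth_on setT f.

(* Partial derivatives exist everywhere, but are not required to be continuous
   here: Ck k f controls the functions obtained by at most k derivations. *)
Record C1 f : Prop := MkC1 {
  C1_continuous : continuous f;
  C1_derivable : forall i x, derivable f x (delta_mx 0 i) }.

Definition Ck k f := forall s, (size s <= k)%N -> C1 (partials s f).

Lemma smoothCk f : smooth f <-> forall k, Ck k f.
Proof.
split=> [sf k s _|sf s x _].
  by split=> [x|i x]; [exact: (sf s x I).1|exact: (sf s x I).2].
have [cf df] := sf (size s) s (leqnn _).
by split=> [|i]; [exact: cf|exact: df].
Qed.

Lemma Ck0 k f : Ck k f -> C1 f. Proof. by move=> /(_ [::]); exact. Qed.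

Lemma C1Ck f : C1 f -> Ck 0 f.
Proof. by move=> f1 s; rewrite leqn0 size_eq0 => /eqP ->; exact: f1. Qed.

Lemma CkS k f : Ck k.+1 f <-> C1 f /\ forall i, Ck k (partial i f).
Proof.
split=> [kf|[f1 kf] [_|i s]]; [|exact: f1|exact: kf].
by split=> [|i s sk]; [exact: Ck0 kf|exact: (kf (i :: s))].
Qed.

Lemma CkW k f : Ck k.+1 f -> Ck k f.
Proof. by move=> kf s sk; apply: kf; exact: leqW. Qed.

Lemma partialD i f g : C1 f -> C1 g ->
  partial i (f + g) = partial i f + partial i g.
Proof.
move=> f1 g1; apply/funext => x; rewrite /partial.
by apply: deriveD; apply: C1_derivable.
Qed.

Lemma partialM i f g : C1 f -> C1 g ->
  partial i (f * g) = f * partial i g + g * partial i f.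
Proof.
move=> f1 g1; apply/funext => x; rewrite /partial.
by apply: deriveM; apply: C1_derivable.
Qed.

Lemma C1D f g : C1 f -> C1 g -> C1 (f + g).
Proof.
move=> [cf df] [cg dg]; split=> [x|i x].
  by apply: continuousD; [exact: cf|exact: cg].
by apply: derivableD; [exact: df|exact: dg].
Qed.

Lemma C1M f g : C1 f -> C1 g -> C1 (f * g).
Proof.
move=> [cf df] [cg dg]; split=> [x|i x].
  by apply: continuousM; [exact: cf|exact: cg].
by apply: derivableM; [exact: df|exact: dg].
Qed.

Lemma CkD k f g : Ck k f -> Ck k g -> Ck k (f + g).
Proof.
elim: k f g => [|k IH] f g.
  by move=> /Ck0 f1 /Ck0 g1; apply: C1Ck; exact: C1D f1 g1.
move=> /CkS[f1 kf] /CkS[g1 kg]; apply/CkS; split=> [|i].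
  exact: C1D f1 g1.
rewrite (partialD _ f1 g1); exact: IH (kf i) (kg i).
Qed.

Lemma CkM k f g : Ck k f -> Ck k g -> Ck k (f * g).
Proof.
elim: k f g => [|k IH] f g.
  by move=> /Ck0 f1 /Ck0 g1; apply: C1Ck; exact: C1M f1 g1.
move=> kf kg; move: (kf) (kg) => /CkS[f1 kf'] /CkS[g1 kg'].
apply/CkS; split=> [|i]; first exact: C1M f1 g1.
rewrite (partialM _ f1 g1).
exact: CkD (IH _ _ (CkW kf) (kg' i)) (IH _ _ (CkW kg) (kf' i)).
Qed.

Lemma partial_cst i (c : R) : partial i (cst c) = cst 0.
Proof. by apply/funext => x; rewrite /partial derive_cst. Qed.

Lemma C1_cst (c : R) : C1 (cst c).
Proof.
by split=> [x|i x]; [exact: cst_continuous|exact: derivable_cst].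
Qed.

Lemma smooth_cst (c : R) : smooth (cst c).
Proof.
apply/smoothCk => k; elim: k c => [|k IH] c; first exact: C1Ck (C1_cst c).
apply/CkS; split=> [|i]; first exact: C1_cst.
rewrite partial_cst; exact: IH.
Qed.

Lemma smoothC1 f : smooth f -> C1 f.
Proof. by move=> /smoothCk/(_ 0%N)/Ck0. Qed.

Lemma smoothD f g : smooth f -> smooth g -> smooth (f + g).
Proof.
move=> /smoothCk sf /smoothCk sg; apply/smoothCk => k.
exact: CkD (sf k) (sg k).
Qed.

Lemma smoothM f g : smooth f -> smooth g -> smooth (f * g).
Proof.
move=> /smoothCk sf /smoothCk sg; apply/smoothCk => k.
exact: CkM (sf k) (sg k).
Qed.

Lemma smoothZ (c : R) f : smooth f -> smooth (c *: f).
Proof. by move=> sf; exact: smoothM (smooth_cst c) sf. Qed.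

Lemma smooth_partial i f : smooth f -> smooth (partial i f).
Proof. by move=> sf s; exact: (sf (i :: s)). Qed.

Lemma partial_coord i j :
  partial i (fun x => x 0 j) = cst (i == j)%:R.
Proof.
apply/funext => x; rewrite /partial.
have lc : linear (fun x : 'rV[R]_n => x 0 j) by move=> a u v; rewrite !mxE.
pose c := HB.pack_for {linear 'rV[R]_n -> R} (fun x : 'rV[R]_n => x 0 j)
  (GRing.isLinear.Build R 'rV[R]_n R _ _ lc).
rewrite deriveE; last exact: differentiable_coord.
rewrite (@diff_lin _ _ _ c x) /=; first by rewrite mxE eqxx eq_sym.
exact: (@coord_continuous R 1 n 0 j).
Qed.

Lemma C1_coord j : C1 (fun x => x 0 j).
Proof.
split=> [|i x]; first exact: coord_continuous.
by apply: diff_derivable; exact: differentiable_coord.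
Qed.

Lemma smooth_coord j : smooth (fun x => x 0 j).
Proof.
apply/smoothCk => -[|k]; first exact: C1Ck (C1_coord j).
apply/CkS; split=> [|i]; first exact: C1_coord.
rewrite partial_coord; exact: (smoothCk _).1 (smooth_cst _) k.
Qed.

Lemma smooth0 : smooth 0. Proof. exact: smooth_cst 0. Qed.
Lemma smooth1 : smooth 1. Proof. exact: smooth_cst 1. Qed.
Lemma smoothN f : smooth f -> smooth (- f).
Proof. by move=> sf; rewrite -scaleN1r; exact: smoothZ. Qed.

Record Cinf : Type := MkCinf {
  Cinf_val :> 'rV[R]_n -> R;
  Cinf_smooth : smooth Cinf_val }.

HB.instance Definition _ := gen_eqMixin Cinf.
HB.instance Definition _ := gen_choiceMixin Cinf.

Lemma Cinf_inj (f g : Cinf) : (forall x, f x = g x) -> f = g.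
Proof.
case: f g => f sf [g sg] /= /funext fg.
by case: _ / fg in sg *; congr MkCinf; exact: Prop_irrelevance.
Qed.

Definition Cinf_add (f g : Cinf) :=
  MkCinf (smoothD (Cinf_smooth f) (Cinf_smooth g)).
Definition Cinf_opp (f : Cinf) := MkCinf (smoothN (Cinf_smooth f)).
Definition Cinf_mul (f g : Cinf) :=
  MkCinf (smoothM (Cinf_smooth f) (Cinf_smooth g)).
Definition Cinf_scale (a : R) (f : Cinf) :=
  MkCinf (smoothZ a (Cinf_smooth f)).
Definition Cinf_zero := MkCinf smooth0.
Definition Cinf_one := MkCinf smooth1.

Lemma Cinf_addA : associative Cinf_add.
Proof. by move=> f g h; apply: Cinf_inj => x; exact: addrA. Qed.
Lemma Cinf_addC : commutative Cinf_add.
Proof. by move=> f g; apply: Cinf_inj => x; exact: addrC. Qed.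
Lemma Cinf_add0 : left_id Cinf_zero Cinf_add.
Proof. by move=> f; apply: Cinf_inj => x; exact: add0r. Qed.
Lemma Cinf_addN : left_inverse Cinf_zero Cinf_opp Cinf_add.
Proof. by move=> f; apply: Cinf_inj => x; exact: addNr. Qed.
HB.instance Definition _ := GRing.isZmodule.Build Cinf
  Cinf_addA Cinf_addC Cinf_add0 Cinf_addN.

Lemma Cinf_mulA : associative Cinf_mul.
Proof. by move=> f g h; apply: Cinf_inj => x; exact: mulrA. Qed.
Lemma Cinf_mulC : commutative Cinf_mul.
Proof. by move=> f g; apply: Cinf_inj => x; exact: mulrC. Qed.
Lemma Cinf_mul1 : left_id Cinf_one Cinf_mul.
Proof. by move=> f; apply: Cinf_inj => x; exact: mul1r. Qed.
Lemma Cinf_mulDl : left_distributive Cinf_mul Cinf_add.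
Proof. by move=> f g h; apply: Cinf_inj => x; exact: mulrDl. Qed.
Lemma Cinf_1neq0 : Cinf_one != 0.
Proof.
apply/eqP => /(congr1 (fun f : Cinf => f 0)) /eqP.
by apply/negP; exact: oner_neq0.
Qed.
HB.instance Definition _ := GRing.Zmodule_isComNzRing.Build Cinf
  Cinf_mulA Cinf_mulC Cinf_mul1 Cinf_mulDl Cinf_1neq0.

Lemma Cinf_scaleA a b (f : Cinf) : Cinf_scale a (Cinf_scale b f) = Cinf_scale (a * b) f.
Proof. by apply: Cinf_inj => x; exact: mulrA. Qed.
Lemma Cinf_scale1 : left_id 1 Cinf_scale.
Proof. by move=> f; apply: Cinf_inj => x; exact: mul1r. Qed.
Lemma Cinf_scaleDr : right_distributive Cinf_scale +%R.
Proof. by move=> a f g; apply: Cinf_inj => x; exact: mulrDr. Qed.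
Lemma Cinf_scaleDl (f : Cinf) : {morph Cinf_scale^~ f : a b / a + b}.
Proof. by move=> a b; apply: Cinf_inj => x; exact: mulrDl. Qed.
HB.instance Definition _ := GRing.Zmodule_isLmodule.Build R Cinf
  Cinf_scaleA Cinf_scale1 Cinf_scaleDr Cinf_scaleDl.

Lemma Cinf_scaleAl (a : R) (f g : Cinf) : a *: (f * g) = a *: f * g.
Proof. by apply: Cinf_inj => x; exact: mulrA. Qed.
HB.instance Definition _ :=
  GRing.Lmodule_isLalgebra.Build R Cinf Cinf_scaleAl.
HB.instance Definition _ := GRing.Lalgebra_isComAlgebra.Build R Cinf.

Lemma CinfD (f g : Cinf) x : (f + g) x = f x + g x. Proof. by []. Qed.
Lemma CinfN (f : Cinf) x : (- f) x = - f x. Proof. by []. Qed.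
Lemma CinfM (f g : Cinf) x : (f * g) x = f x * g x. Proof. by []. Qed.
Lemma CinfZ a (f : Cinf) x : (a *: f) x = a * f x. Proof. by []. Qed.
Lemma Cinf0 x : (0 : Cinf) x = 0. Proof. by []. Qed.
Lemma Cinf1 x : (1 : Cinf) x = 1. Proof. by []. Qed.

Definition coord (j : 'I_n) : Cinf := MkCinf (smooth_coord j).

Definition pd (i : 'I_n) (f : Cinf) : Cinf :=
  MkCinf (smooth_partial i (Cinf_smooth f)).

Lemma pd_linear i : linear (pd i).
Proof.
move=> a f g; apply: Cinf_inj => x.
have f1 := smoothC1 (Cinf_smooth f).
have g1 := smoothC1 (Cinf_smooth g).
have af1 := smoothC1 (smoothZ a (Cinf_smooth f)).
rewrite -[LHS]/(partial i (a *: (f : 'rV[R]_n -> R) + g) x) (partialD _ af1 g1).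
congr (_ + _); apply: deriveZ; exact: C1_derivable.
Qed.
HB.instance Definition _ i := GRing.isLinear.Build R Cinf Cinf _ (pd i)
  (pd_linear i).

Lemma pdM i (f g : Cinf) : pd i (f * g) = f * pd i g + g * pd i f.
Proof.
apply: Cinf_inj => x.
have f1 := smoothC1 (Cinf_smooth f); have g1 := smoothC1 (Cinf_smooth g).
exact: (congr1 (@^~ x) (partialM i f1 g1)).
Qed.

Lemma pd_coord i j : pd i (coord j) = (i == j)%:R.
Proof.
apply: Cinf_inj => x; rewrite -[LHS]/(partial i (fun x => x 0 j) x).
by rewrite partial_coord; case: (i == j).
Qed.

End SmoothFunctions.

(* Vector fields on R^n, by their coordinates in the frame of the partial
   derivatives. *)
Notation Vect R n := 'rV[Cinf R n]_n.

Section VectorFields.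
Variables (R : realType) (n : nat).
Local Notation C := (Cinf R n).

Definition vapp (V : Vect R n) (f : C) : C := \sum_i V 0 i * pd i f.

Definition bracket (V W : Vect R n) : Vect R n :=
  \row_j (vapp V (W 0 j) - vapp W (V 0 j)).

(* Every point has an open neighbourhood U on which sections e_i of E restrict
   to a C^oo(U)-basis of the module generated by the restrictions of E. *)
Definition locally_free (E : {pred Vect R n}) : Prop :=
  forall x : 'rV[R]_n, exists U : set 'rV[R]_n, [/\ open U, U x &
    exists (r : nat) (e : 'I_r -> Vect R n),
    [/\ forall i, e i \in E,
        (forall V : Vect R n, V \in E -> exists f : 'I_r -> 'rV[R]_n -> R,
           (forall i, smooth_on U (f i)) /\
           (forall y, U y -> forall j, V 0 j y = \sum_i f i y * e i 0 j y)) &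
        (forall f : 'I_r -> 'rV[R]_n -> R, (forall i, smooth_on U (f i)) ->
           (forall y, U y -> forall j, \sum_i f i y * e i 0 j y = 0) ->
           forall i y, U y -> f i y = 0)]].

Definition involutive (E : {pred Vect R n}) : Prop :=
  {in E &, forall V W, bracket V W \in E}.

Record Estructure := MkEstructure {
  Esub :> submodClosed (Vect R n);
  E_locally_free : locally_free Esub;
  E_involutive : involutive Esub }.


Lemma vapp_linear (V : Vect R n) : linear (vapp V).
Proof.
move=> a f g; rewrite /vapp scaler_sumr -big_split /=; apply: eq_bigr => i _.
by rewrite linearP mulrDr scalerAr.
Qed.
HB.instance Definition _ V := GRing.isLinear.Build R C C _ (vapp V)
  (vapp_linear V).

Lemma vappM (V : Vect R n) (f g : C) :
  vapp V (f * g) = f * vapp V g + g * vapp V f.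
Proof.
rewrite /vapp !mulr_sumr -big_split; apply: eq_bigr => i _ /=.
by rewrite pdM mulrDr; congr (_ + _); rewrite mulrCA.
Qed.

Lemma vapp_comb (a b : C) (V W : Vect R n) f :
  vapp (a *: V + b *: W) f = a * vapp V f + b * vapp W f.
Proof.
rewrite /vapp !mulr_sumr -big_split; apply: eq_bigr => i _ /=.
by rewrite !mxE mulrDl !mulrA.
Qed.

End VectorFields.

Lemma fct_linE (R : pzRingType) (T : Type) (M : lmodType R) (a : R)
  (f g : T -> M) x : (a *: f + g) x = a *: f x + g x.
Proof. by []. Qed.

Section Forms.
Variables (R : realType) (n : nat) (E : Estructure R n).
Local Notation C := (Cinf R n).

Record Esection : Type := MkEsection {
  Esection_val :> Vect R n;
  Esection_valP : Esection_val \in (E : submodClosed _) }.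

HB.instance Definition _ := [isSub for Esection_val].
HB.instance Definition _ := [Choice of Esection by <:].
HB.instance Definition _ := [SubChoice_isSubLmodule of Esection by <:].

Definition Ebracket (V W : Esection) : Esection :=
  MkEsection (E_involutive (Esection_valP V) (Esection_valP W)).

Definition upd p (V : 'I_p -> Esection) (k : 'I_p) (u : Esection) :
  'I_p -> Esection := fun j => if j == k then u else V j.

Definition multilinear p (w : ('I_p -> Esection) -> C) : Prop :=
  forall V k (a : C) u v,
    w (upd V k (a *: u + v)) = a * w (upd V k u) + w (upd V k v).

Definition alternating p (w : ('I_p -> Esection) -> C) : Prop :=
  forall V i j, i != j -> V i = V j -> w V = 0.

Definition form_pred p : {pred ('I_p -> Esection) -> C} :=
  fun w => `[< multilinear w /\ alternating w >].

Lemma form_submod p : submod_closed (@form_pred p).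
Proof.
split.
  apply/asboolP; split=> [V k a u v|V i j _ _] //.
  by rewrite /GRing.zero/= mulr0 addr0.
move=> a w1 w2 /asboolP[m1 a1] /asboolP[m2 a2]; apply/asboolP; split.
  move=> V k b u v; rewrite !fct_linE m1 m2.
  by rewrite scalerDr mulrDr scalerAr addrACA.
move=> V i j ij Vij; rewrite !fct_linE.
by rewrite (a1 _ _ _ ij Vij) (a2 _ _ _ ij Vij) scaler0 add0r.
Qed.
HB.instance Definition _ p :=
  GRing.isSubmodClosed.Build R (('I_p -> Esection) -> C) (@form_pred p)
    (@form_submod p).

(* The sections of the p-th exterior power of the dual of E, as alternating
   C^oo-multilinear maps on sections of E. *)
Record Eform p : Type := MkEform {
  Eform_val :> ('I_p -> Esection) -> C;
  Eform_valP : Eform_val \in @form_pred p }.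

HB.instance Definition _ p := [isSub for @Eform_val p].
HB.instance Definition _ p := [Choice of Eform p by <:].
HB.instance Definition _ p := [SubChoice_isSubLmodule of Eform p by <:].

(* The Koszul formula, on arbitrary functions of p sections. The increasing
   enumeration of the indices other than i < j is m |-> bump j (bump i m); as
   position 0 is taken by the bracket, it is used at m = k.-1. *)
Definition Ed p (w : ('I_p -> Esection) -> C) : ('I_p.+1 -> Esection) -> C :=
  fun V =>
    \sum_(i < p.+1) (-1) ^+ i * vapp (V i) (w (fun k => V (lift i k))) +
    \sum_(i < p.+1) \sum_(j < p.+1 | (i < j)%N)
      (-1) ^+ (i + j) *
      w (fun k => if k == 0%N :> nat then Ebracket (V i) (V j)
                  else V (inord (bump j (bump i k.-1)))).

Lemma Ed_linear p : linear (@Ed p).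
Proof.
move=> a f g; apply/funext => V; rewrite /Ed.
rewrite !fct_linE.
rewrite scalerDr addrACA; congr (_ + _); rewrite scaler_sumr -big_split /=.
  apply: eq_bigr => i _.
  by rewrite fct_linE linearP mulrDr scalerAr.
apply: eq_bigr => i _; rewrite scaler_sumr -big_split /=.
apply: eq_bigr => j _.
by rewrite fct_linE mulrDr scalerAr.
Qed.

Definition closed_pred p : {pred Eform p} :=
  fun w => `[< forall V, Ed w V = 0 >].

Lemma closed_submod p : submod_closed (@closed_pred p).
Proof.
split=> [|a f g].
  apply/asboolP => V.
  have := Ed_linear (-1) (0 : ('I_p -> Esection) -> C) 0.
  by rewrite scaler0 addr0 scaleN1r addNr => /(congr1 (@^~ V)).
move=> /asboolP cf /asboolP cg; apply/asboolP => V.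
rewrite (Ed_linear a f g) !fct_linE.
by rewrite cf cg scaler0 addr0.
Qed.
HB.instance Definition _ p :=
  GRing.isSubmodClosed.Build R (Eform p) (@closed_pred p) (@closed_submod p).

Record Eclosed p : Type := MkEclosed {
  Eclosed_val :> Eform p;
  Eclosed_valP : Eclosed_val \in @closed_pred p }.

HB.instance Definition _ p := [isSub for @Eclosed_val p].
HB.instance Definition _ p := [Choice of Eclosed p by <:].
HB.instance Definition _ p := [SubChoice_isSubLmodule of Eclosed p by <:].

(* Only used on closed forms: the coboundaries form a subspace of the closed
   forms because Ed \o Ed = 0. *)
Definition exact_form p : Eform p -> Prop :=
  match p return Eform p -> Prop with
  | 0 => fun w => w = 0
  | q.+1 => fun w => exists e : Eform q, Eform_val w = Ed e
  end.

Definition exact_pred p : {pred Eclosed p} := fun w => `[< exact_form w >].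

Lemma exact_submod p : submod_closed (@exact_pred p).
Proof.
split.
  apply/asboolP; case: p => [|p] //=; exists 0.
  have := Ed_linear (-1) (0 : ('I_p -> Esection) -> C) 0.
  by rewrite scaler0 addr0 scaleN1r addNr.
move=> a f g /asboolP; case: p f g => [|p] f g /= ef /asboolP /= eg.
  by apply/asboolP => /=; rewrite ef eg scaler0 addr0.
apply/asboolP => /=; case: ef eg => [e1 fe1] [e2 ge2].
by exists (a *: e1 + e2); rewrite (Ed_linear a e1 e2) -fe1 -ge2.
Qed.
HB.instance Definition _ p :=
  GRing.isSubmodClosed.Build R (Eclosed p) (@exact_pred p) (@exact_submod p).

Definition Ecohomology p : lmodType R := lquot (@exact_pred p).

End Forms.

Section ScalingRotation.
Variable R : realType.
Local Notation C := (Cinf R 2).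

Let x : C := coord R 0.
Let y : C := coord R 1.

Definition v1 : Vect R 2 := \row_j [:: x; y]`_j.
Definition v2 : Vect R 2 := \row_j [:: - y; x]`_j.

(* The C^oo(R^2)-submodule generated by v1 and v2. *)
Definition v12_pred : {pred Vect R 2} :=
  fun V => `[< exists a b : C, V = a *: v1 + b *: v2 >].

Lemma v12_submod : submod_closed v12_pred.
Proof.
split; first by apply/asboolP; exists 0, 0; rewrite !scale0r addr0.
move=> c V W /asboolP[a [b ->]] /asboolP[a' [b' ->]]; apply/asboolP.
exists (c * a + a'), (c * b + b').
by rewrite scalerDr !scalerDl !scalerA addrACA.
Qed.
HB.instance Definition _ :=
  GRing.isSubmodClosed.Build C (Vect R 2) v12_pred v12_submod.

Lemma v12_involutive : involutive v12_pred.
Proof.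
move=> V W /asboolP[a [b ->]] /asboolP[c [d ->]]; apply/asboolP.
set V' := _ + _; set W' := _ + _.
exists (vapp V' c - vapp W' a), (vapp V' d - vapp W' b).
apply/rowP => j; rewrite !mxE ![vapp _ (_ + _)]linearD /= !vappM.
rewrite !(vapp_comb _ _ _ _ (_`_j)).
have ux : vapp v1 x = x.
  rewrite /vapp !big_ord_recl big_ord0 !mxE /= !pd_coord /=. ring.
have uy : vapp v1 y = y.
  rewrite /vapp !big_ord_recl big_ord0 !mxE /= !pd_coord /=. ring.
have wx : vapp v2 x = - y.
  rewrite /vapp !big_ord_recl big_ord0 !mxE /= !pd_coord /=. ring.
have wy : vapp v2 y = x.
  rewrite /vapp !big_ord_recl big_ord0 !mxE /= !pd_coord /=. ring.
by case: j => -[|[|//]] /= _; rewrite ?linearN /= !(ux, uy, wx, wy); ring.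
Qed.

Lemma v12_locally_free : locally_free v12_pred.
Proof.
move=> p; exists setT; split => //; first exact: openT.
exists 2%N, (fun i => if i == 0 then v1 else v2); split.
- move=> i; apply/asboolP; case: ifP => _.
    by exists 1, 0; rewrite scale1r scale0r addr0.
  by exists 0, 1; rewrite scale1r scale0r add0r.
- move=> V /asboolP[a [b ->]].
  exists (fun i => if i == 0 then a : _ -> _ else b); split.
    by move=> i; case: ifP => _; exact: Cinf_smooth.
  by move=> z _ j; rewrite !big_ord_recl big_ord0 addr0 !mxE.
- move=> f sf fe.
  have f0 i z : z != 0 -> f i z = 0.
    move=> z0; have := fe z I 0; have := fe z I 1.
    rewrite !big_ord_recl !big_ord0 !addr0 !mxE /=.
    set g0 := f _ z; set g1 := f _ z; set u := z 0 0; set w := z 0 1 => e1.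
    rewrite -[X in g1 * X]/(- w) => e0.
    have uw : u ^+ 2 + w ^+ 2 != 0.
      apply: contraNneq z0 => uw; apply/eqP/rowP => j; rewrite mxE.
      have [u0 w0] : u = 0 /\ w = 0 by split; nra.
      case: j => -[|[|//]] j2; [rewrite -u0|rewrite -w0].
        by congr (z 0 _); exact: val_inj.
      by congr (z 0 _); exact: val_inj.
    have -> : f i z = if i == 0 then g0 else g1.
      case: i => -[|[|//]] j2 /=; rewrite /g0 /g1; congr (f _ z); exact: val_inj.
    case: ifP => _; apply: (mulIf uw); rewrite mul0r.
      transitivity (u * (g0 * u + g1 * - w) + w * (g0 * w + g1 * u)); first ring.
      by rewrite e0 e1; ring.
    transitivity (u * (g0 * w + g1 * u) - w * (g0 * u + g1 * - w)); first ring.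
    by rewrite e0 e1; ring.
  move=> i z _; have [->|/f0//] := eqVneq z 0.
  have cf : {for 0, continuous (f i)} := (sf i [::] 0 I).1.
  pose v : 'rV[R]_2 := const_mx 1.
  apply: (@cvg_unique _ (@Rhausdorff R) ((fun t : R => f i (t *: v)) @ 0^')).
    have cv : (fun t : R => t *: v) @ (0 : R) --> (0 : 'rV[R]_2).
      by rewrite -(scale0r v); exact: scalel_continuous.
    exact: cvg_trans (cvg_app _ (@nbhs_dnbhs _ (0 : R))) (cvg_comp _ _ cv cf).
  apply: cvg_near_cst; near=> t.
  apply: f0; apply/eqP => /rowP/(_ 0); rewrite !mxE mulr1 => t0.
  have : t != 0 by near: t; exact: nbhs_dnbhs_neq.
  by rewrite -t0 eqxx.
Unshelve. all: by end_near. Qed.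

Definition E12 : Estructure R 2 :=
  MkEstructure v12_locally_free v12_involutive.
End ScalingRotation.

(* Main.v *)
From HB Require Import structures.
Require Import Defs.
From mathcomp Require Import all_boot all_order all_algebra.
From mathcomp Require Import ring lra.
From mathcomp Require Import all_classical all_reals all_analysis.

Set Implicit Arguments.
Unset Strict Implicit.
Unset Printing Implicit Defensive.

Import Order.TTheory GRing.Theory Num.Theory.
Import numFieldTopology.Exports numFieldNormedType.Exports.
Local Open Scope classical_set_scope.
Local Open Scope ring_scope.

(** Write [L1] and [L2] for the derivations given by [v1] (the Euler field
    x d/dx + y d/dy) and [v2] (the rotation field).  They commute, and the
    sections of E are freely generated by [v1] and [v2], so in the dual frame
    [th1], [th2] the complex of E-forms is
<<
        f |-> (L1 f, L2 f),      (a, b) |-> L1 b - L2 a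
>>
    on smooth functions, and it vanishes above degree 2.  Both fields vanish at
    the origin, so every [L1 f] and [L2 f] does: evaluating the coefficients of
    a form at the origin is a map on cohomology.  It is onto, because the
    forms with constant coefficients in the dual frame are closed.

    That it is one-to-one rests on a single fact: [L1] is a bijection of the
    space of smooth functions vanishing at the origin.  If [L1 f = 0] then f is
    constant along rays, hence constant ([radial_eq0]); and [L1 g = f] is
    solvable as soon as f vanishes at the origin ([radial_surj]).
    - In degree 0 a closed form is a constant.
    - In degree 1, if [L1 b = L2 a] with [a] and [b] zero at the origin, solve
      [L1 f = a]; then [L1 (L2 f - b) = L2 a - L1 b = 0], so [L2 f - b] is the
      constant [0].
    - In degree 2, solve [L1 b = c]; the form [c th1 /\ th2] is the differential
      of [b th2].

    To solve [L1 g = f] smoothly, let [S f x] be the mean of [f (t x)] over t in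
    [0, 1] ([raymean 0]).  Since the derivative of [t f (t x)] in t is [(f + L1 f) (t x)], one
    has [(L1 + 1) (S f) = f], that is, [S] inverts [L1 + 1].  Differentiation
    under the integral sign shows that [S] preserves smoothness.  As
    [L1 (x_i h) = x_i (L1 + 1) h], the function [g = sum_i x_i S (S (d_i f))]
    satisfies [L1 g = sum_i x_i S (d_i f)], which is [f - f 0] by Hadamard's
    lemma.

    Smoothness means here that iterated partial derivatives exist and are
    continuous; from this the mean value theorem gives the two facts of calculus
    used above, the chain rule along rays ([Ck1_is_derive_ray]) and the symmetry
    of second derivatives ([Ck2_partialC]), hence [L1 L2 = L2 L1]. *)

(** * Derivatives along lines and rays *)

Section Rays.
Variables (R : realType) (n : nat).
Implicit Types (g : 'rV[R]_n -> R) (a b v w : 'rV[R]_n) (i : 'I_n).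

Lemma derivable_line g b v : (forall x, derivable g x v) ->
  forall t : R, is_derive t 1 (fun s => g (b + s *: v)) ('D_v g (b + t *: v)).
Proof.
move=> dg t.
have E : (fun h : R => h^-1 *: ((fun s => g (b + s *: v)) (h *: (1 : R) + t)
                - g (b + t *: v)))
       = (fun h : R => h^-1 *: (g (h *: v + (b + t *: v)) - g (b + t *: v))).
  by apply/funext => h; rewrite /= scaler1 scalerDl addrCA.
apply: DeriveDef.
  by rewrite /derivable E; exact: dg.
by rewrite /derive E.
Qed.

(** The point is only located up to [`|s|], on either side of [b]: this makes
    the statement uniform in the sign of [s], and is enough for the limits
    below. *)
Lemma partial_MVT i g b (s : R) : (forall x, derivable g x (delta_mx 0 i)) ->
  exists2 xi, `|xi| <= `|s| &
    g (b + s *: delta_mx 0 i) - g b = s * partial i g (b + xi *: delta_mx 0 i).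
Proof.
move=> dg; have df := derivable_line b dg.
have cf : continuous (fun s : R => g (b + s *: delta_mx 0 i)).
  move=> t; apply: differentiable_continuous; apply/derivable1_diffP.
  by have [] := df t.
have [s0|s0] := leP 0 s.
  have [|xi xis] := MVT_segment s0 (fun t _ => df t).
    exact: continuous_subspaceT.
  rewrite scale0r addr0 subr0 mulrC => e; exists xi => //.
  by move: xis; rewrite in_itv/= => /andP[x0 xs]; rewrite !ger0_norm.
have [|xi xis] := MVT_segment (ltW s0) (fun t _ => df t).
  exact: continuous_subspaceT.
rewrite scale0r addr0 => e; exists xi => //.
  move: xis; rewrite in_itv/= => /andP[x0 xs].
  by rewrite !ler0_norm ?lerN2// ltW.
by rewrite -opprB e /partial; ring.
Qed.

(** The increment of [g] from [a + h w] to [a + h w + h c e_i] is, by the mean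
    value theorem, [h c] times a value of the i-th partial derivative near [a].
    Adding the coordinates of a vector one at a time in this way gives all
    directional derivatives of a [C^1] function. *)
Lemma derive_add_partial i g a w (c : R) :
  (forall x, derivable g x (delta_mx 0 i)) ->
  {for a, continuous (partial i g)} -> derivable g a w ->
  is_derive a (w + c *: delta_mx 0 i) g ('D_w g a + c * partial i g a).
Proof.
move=> dg cg dw.
pose e : 'rV[R]_n := delta_mx 0 i.
suff H : (fun h : R => h^-1 *: (g (h *: (w + c *: e) + a) - g a)) @ 0^'
    --> 'D_w g a + c * partial i g a.
  apply: DeriveDef; first by apply/cvg_ex; eexists; exact: H.
  exact: cvg_lim H.
have -> : (fun h : R => h^-1 *: (g (h *: (w + c *: e) + a) - g a)) =
    (fun h => h^-1 *: (g (h *: w + a) - g a)) \+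
    (fun h => h^-1 *: (g (h *: w + a + (h * c) *: e) - g (h *: w + a))).
  apply/funext => h /=; rewrite -scalerDr; congr (_ *: _).
  by rewrite scalerDr scalerA addrAC [RHS]addrC subrKA.
apply: cvgD; first exact: dw.
apply/cvgrPdist_le => eps eps0.
have e1 : 0 < eps / (`|c| + 1) by rewrite divr_gt0// ltr_wpDl.
have /(@cvgrPdist_le _ _ _ (nbhs a))/(_ _ e1)/nbhs_ballP[d /= d0 Hd] := cg.
pose K := `|w| + `|c| * `|e| + 1.
have K0 : 0 < K by rewrite ltr_wpDl// addr_ge0// mulr_ge0.
near=> h.
have h0 : h != 0 by near: h; exact: nbhs_dnbhs_neq.
have hd : `|h| < d / K by near: h; apply: dnbhs0_lt; exact: divr_gt0.
have [xi xih ->] := partial_MVT (h *: w + a) (h * c) dg.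
rewrite [_ *: _](_ : _ = c * partial i g (h *: w + a + xi *: e)); last first.
  by rewrite -[LHS]/(h^-1 * _) mulrA mulKf.
rewrite -mulrBr normrM.
have : `|partial i g a - partial i g (h *: w + a + xi *: e)| <= eps / (`|c| + 1).
  apply: Hd; rewrite -ball_normE/= addrAC opprD addrCA subrr addr0 normrN.
  apply: le_lt_trans (ler_normD _ _) _; rewrite !normrZ.
  have le : `|xi| * `|e| <= `|h| * `|c| * `|e| by rewrite ler_wpM2r// -normrM.
  rewrite ltr_pdivlMr// /K in hd.
  by rewrite (le_lt_trans _ hd)//; have := normr_ge0 h; nra.
rewrite ler_pdivlMr ?ltr_wpDl// => le.
by apply: le_trans le; rewrite mulrC ler_wpM2l// lerDl.
Unshelve. all: end_near. Qed.

Lemma Ck1_is_derive g a v : Ck 1 g ->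
  is_derive a v g (\sum_i v 0 i * partial i g a).
Proof.
move=> /CkS[g1 dg]; rewrite {1}[v]row_sum_delta.
elim/big_rec2: _ => [|i d w _ Dw].
  apply: DeriveDef.
    apply/cvg_ex; exists 0; apply: cvg_near_cst; near=> h.
    by rewrite /= scaler0 add0r subrr scaler0.
  apply: (@cvg_lim _ (@Rhausdorff R)); apply: cvg_near_cst; near=> h.
  by rewrite /= scaler0 add0r subrr scaler0.
rewrite [_ *: _ + _]addrC [_ * _ + _]addrC.
have [dw <-] := Dw.
have := derive_add_partial (v 0 i) (@C1_derivable _ _ _ g1 i)
  (@C1_continuous _ _ _ (Ck0 (dg i)) a) dw.
exact.
Unshelve. all: end_near. Qed.

Lemma Ck1_is_derive_ray g v (t : R) : Ck 1 g ->
  is_derive t 1 (fun s : R => g (s *: v)) (\sum_i v 0 i * partial i g (t *: v)).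
Proof.
move=> g1; have := @derivable_line g 0 v _ t.
have -> : (fun s : R => g (0 + s *: v)) = (fun s : R => g (s *: v)).
  by apply/funext => s; rewrite add0r.
rewrite add0r (@derive_val _ _ _ _ _ _ _ (Ck1_is_derive (t *: v) v g1)).
by apply=> x; have [] := Ck1_is_derive x v g1.
Qed.

Lemma continuous_ray g v : continuous g -> continuous (fun t : R => g (t *: v)).
Proof.
move=> cg t; apply: (@continuous_comp _ _ _ (fun s : R => s *: v) g).
  exact: scalel_continuous.
exact: cg.
Qed.

End Rays.

(** * Symmetry of second derivatives *)

Section Schwarz.
Variables (R : realType) (n : nat).
Implicit Types (f g : 'rV[R]_n -> R) (i j : 'I_n) (a b x : 'rV[R]_n).

(** The second difference of [f] over the square of side [h] is symmetric in
    [i] and [j] while the right-hand side is not, hence the symmetry of second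
    derivatives as [h] tends to 0. *)
Lemma Ck2_second_difference f i j a (h : R) : Ck 2 f -> h != 0 ->
  exists xi eta : R, [/\ `|xi| <= `|h|, `|eta| <= `|h| &
    f (a + h *: delta_mx 0 i + h *: delta_mx 0 j) - f (a + h *: delta_mx 0 i)
      - (f (a + h *: delta_mx 0 j) - f a)
    = h ^+ 2 * partial j (partial i f)
                 (a + xi *: delta_mx 0 i + eta *: delta_mx 0 j)].
Proof.
move=> /CkS[f1 df] h0.
have d1 k x := @C1_derivable _ _ _ f1 k x.
have d2 k l x := @C1_derivable _ _ _ (Ck0 (df k)) l x.
(* Mean value theorem in direction i for the j-increment g, then in direction j. *)
pose g x := f (x + h *: delta_mx 0 j) - f x.
have dg x : is_derive x (delta_mx 0 i) g
    (partial i f (x + h *: delta_mx 0 j) - partial i f x).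
  have dt : is_derive x (delta_mx 0 i) (fun x => f (x + h *: delta_mx 0 j))
      (partial i f (x + h *: delta_mx 0 j)).
    have E : (fun t : R => t^-1 *: (((fun x => f (x + h *: delta_mx 0 j))
          \o shift x) (t *: delta_mx 0 i) - f (x + h *: delta_mx 0 j)))
      = (fun t : R => t^-1 *: ((f \o shift (x + h *: delta_mx 0 j))
          (t *: delta_mx 0 i) - f (x + h *: delta_mx 0 j))).
      by apply/funext => t /=; rewrite addrA.
    apply: DeriveDef; first by rewrite /derivable E; exact: d1.
    by rewrite /derive E.
  exact: is_deriveB dt (DeriveDef (d1 i x) erefl).
have [x|xi xih e1] := @partial_MVT _ _ i g a h _; first by have [] := dg x.
have [eta etah e2] := partial_MVT (a + xi *: delta_mx 0 i) h (d2 i j).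
exists xi, eta; split => //.
rewrite -[LHS]/(g (a + h *: delta_mx 0 i) - g a) e1 /partial.
by have [_ ->] := dg (a + xi *: delta_mx 0 i); rewrite e2 mulrA expr2.
Qed.

Lemma Ck2_partialC f i j : Ck 2 f ->
  partial i (partial j f) = partial j (partial i f).
Proof.
move=> f2; apply/funext => a.
have [_ df] := (CkS _ _).1 f2.
have cd k l : continuous (partial l (partial k f)).
  have [_ /(_ l)/Ck0 H] := (CkS _ _).1 (df k).
  exact: @C1_continuous _ _ _ H.
apply/eqP; rewrite -subr_eq0 -normr_le0; apply/ler_addgt0Pl => e e0.
rewrite addr0.
have e2 : 0 < e / 2 by rewrite divr_gt0.
pose close k l (h : R) := forall xi eta : R, `|xi| <= `|h| -> `|eta| <= `|h| ->
  `|partial l (partial k f) a - partial l (partial k f)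
      (a + xi *: delta_mx 0 k + eta *: delta_mx 0 l)| < e / 2.
have near_close k l : \forall h \near (0 : R)^', close k l h.
  have /(@cvgrPdist_lt _ _ _ (nbhs a))/(_ _ e2)/nbhs_ballP[d /= d0 Hd] := cd k l a.
  pose N := `|delta_mx 0 k : 'rV[R]_n| + `|delta_mx 0 l : 'rV[R]_n| + 1.
  have N0 : 0 < N by rewrite ltr_wpDl// addr_ge0.
  near=> h => xi eta xih etah; apply: Hd.
  have : `|h| < d / N by near: h; apply: dnbhs0_lt; exact: divr_gt0.
  rewrite ltr_pdivlMr// => hd.
  rewrite -ball_normE/= -addrA opprD addrA subrr add0r normrN.
  apply: le_lt_trans (ler_normD _ _) _; rewrite !normrZ.
  apply: le_lt_trans hd; rewrite /N !mulrDr mulr1.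
  by rewrite ler_wpDr// lerD// ler_wpM2r.
have [h [h0 [Cij Cji]]] := filter_ex (filterI (nbhs_dnbhs_neq (0 : R))
  (filterI (near_close i j) (near_close j i))).
have [xi [eta [xih etah e1]]] := Ck2_second_difference i j a f2 h0.
have [xi' [eta' [xih' etah' e3]]] := Ck2_second_difference j i a f2 h0.
have swap (p q r s : R) : p - q - (r - s) = p - r - (q - s) by ring.
rewrite (addrAC a (h *: delta_mx 0 i)) swap e3 in e1.
have h20 : h ^+ 2 != 0 by rewrite expf_neq0.
rewrite [leRHS]splitr; apply: ltW.
rewrite -(subrKA (partial i (partial j f)
  (a + xi' *: delta_mx 0 j + eta' *: delta_mx 0 i))).
apply: le_lt_trans (ler_normD _ _) _; apply: ltrD.
  exact: Cji xih' etah'.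
rewrite (mulfI h20 e1) distrC.
exact: Cij xih etah.
Unshelve. all: end_near. Qed.

End Schwarz.

(** * Weighted means along rays *)

Section RayMeans.
Variables (R : realType) (n : nat).
Implicit Types (g : 'rV[R]_n -> R) (x v : 'rV[R]_n) (i : 'I_n) (k : nat).
Local Notation mu := lebesgue_measure.

(** The weight [t ^+ k] is what makes the family stable under differentiation:
    each derivative in x brings out one factor [t]. *)
Definition raymean k g x : R := \int[mu]_(t in `[0, 1]) (t ^+ k * g (t *: x)).

Lemma continuous_integrable01 (f : R -> R) :
  continuous f -> mu.-integrable `[0, 1] (EFin \o f).
Proof.
move=> cf; apply: continuous_compact_integrable; first exact: segment_compact.
exact: continuous_subspaceT.
Qed.

Lemma ray_continuous k g x : continuous g ->
  continuous (fun t : R => t ^+ k * g (t *: x)).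
Proof.
by move=> cg t; apply: cvgM; [exact: exprn_continuous|exact: continuous_ray].
Qed.

(** Compactness of the segment [0, 1] makes the continuity of [g] at the points
    of the ray uniform. *)
Lemma near_ray_uniform g x (e : R) : continuous g -> 0 < e ->
  \forall y \near x, forall t : R, `[0, 1]%classic t -> `|g (t *: x) - g (t *: y)| < e.
Proof.
move=> cg e0; have := @segment_compact R 0 1.
move=> /compact_near_coveringP/(_ _ (nbhs x)
  (fun y (t : R) => `|g (t *: x) - g (t *: y)| < e)) H.
apply: H => t _.
have csc : {for (t, x), continuous (fun p : R * 'rV[R]_n => p.1 *: p.2)}.
  exact: (@scale_continuous R _ (t, x)).
have cgs : {for (t, x), continuous (fun p : R * 'rV[R]_n => g (p.1 *: p.2))}.
  by apply: continuous_comp csc _; exact: cg.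
have e2 : 0 < e / 2 by rewrite divr_gt0.
have /cvgrPdist_lt/(_ _ e2) N1 := cgs.
have cgx : {for (t, x), continuous (fun p : R * 'rV[R]_n => g (p.1 *: x))}.
  apply: (@continuous_comp _ _ _ fst (fun s : R => g (s *: x))).
    exact: cvg_fst.
  exact: continuous_ray.
have /cvgrPdist_lt/(_ _ e2) N2 := cgx.
apply: filterS2 N1 N2 => -[s y] /= N1 N2.
rewrite [ltRHS]splitr -(subrKA (g (t *: x))).
by apply: le_lt_trans (ler_normD _ _) _; apply: ltrD; rewrite // distrC.
Qed.

Lemma raymean_continuous k g : continuous g -> continuous (raymean k g).
Proof.
move=> cg x; apply/(@cvgrPdist_le _ _ _ (nbhs x)) => e e0.
near=> y.
rewrite /raymean -RintegralB//; [|exact/continuous_integrable01/ray_continuous..].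
apply: le_trans (le_normr_Rintegral _ _) _ => //.
  apply: continuous_integrable01 => t.
  by apply: cvgB; exact: ray_continuous.
have -> : e = \int[mu]_(t in `[0, 1]) cst e t.
  by rewrite Rintegral_cst//= lebesgue_measure_itv/= lte01 oppr0 adde0 mulr1.
apply: le_Rintegral => //.
- apply: continuous_integrable01 => t.
  by apply: cvg_norm; apply: cvgB; exact: ray_continuous.
- by apply: continuous_integrable01; exact: cst_continuous.
move=> t t01; rewrite -mulrBr normrM.
have : `|g (t *: x) - g (t *: y)| < e.
  by move: t t01; near: y; exact: near_ray_uniform.
move: t01; rewrite /= in_itv/= => /andP[t0 t1] /ltW le.
rewrite ger0_norm ?exprn_ge0//.
by rewrite -[leRHS]mul1r ler_pM ?exprn_ge0// exprn_ile1.
Unshelve. all: end_near. Qed.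

Lemma bounded_segment2 (F : R * R -> R) : continuous F ->
  exists M : R, forall s t, `[-1, 1]%classic s -> `[0, 1]%classic t -> `|F (s, t)| <= M.
Proof.
move=> cF.
have := continuous_compact (continuous_subspaceT cF)
  (compact_setX (@segment_compact R (-1) 1) (@segment_compact R 0 1)).
move=> /compact_bounded[M [_ HM]]; exists (M + 1) => s t s1 t01.
by apply: (HM (M + 1)); [rewrite ltrDl|exists (s, t)].
Qed.

(** Differentiation under the integral sign, in the one real variable [s] along
    the direction [e_i] at [x]; the domination is by a bound of the continuous
    integrand [F] on a compact rectangle. *)
Lemma raymean_is_derive k i g x : C1 g -> continuous (partial i g) ->
  is_derive x (delta_mx 0 i) (raymean k g) (raymean k.+1 (partial i g) x).
Proof.
move=> g1 cdg; pose e : 'rV[R]_n := delta_mx 0 i.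
have cg : continuous g := @C1_continuous _ _ _ g1.
pose f (s t : R) := t ^+ k * g (t *: (x + s *: e)).
pose F (p : R * R) : R := p.2 ^+ k.+1 * partial i g (p.2 *: (x + p.1 *: e)).
have df (s t : R) : is_derive s 1 (f^~ t) (F (s, t)).
  have H := derivable_line (t *: x) (@C1_derivable _ _ _ g1 i) (t * s).
  have K : is_derive s 1 ( *%R t) t.
    have := @is_deriveZ _ _ _ (@id R) t s 1 1 (is_derive_id _ _).
    by rewrite /GRing.scale/= mulr1.
  have := @is_deriveZ _ _ _ _ (t ^+ k) _ _ _ (@is_derive1_comp _ _ _ _ _ _ H K).
  have -> : F (s, t) = t ^+ k *: ('D_e g (t *: x + (t * s) *: e) * t).
    by rewrite /F/= exprSr -mulrA [_ * t]mulrC scalerDr scalerA.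
  suff -> : f^~ t = t ^+ k \*: ((fun s => g (t *: x + s *: e)) \o *%R t) by [].
  by apply/funext => u; rewrite /f/= scalerDr scalerA.
have cF : continuous F.
  move=> p; apply: cvgM.
    apply: (@continuous_comp _ _ _ snd (fun t : R => t ^+ k.+1)).
      exact: cvg_snd.
    exact: exprn_continuous.
  apply: (@continuous_comp _ _ _ (fun p : R * R => p.2 *: (x + p.1 *: e))
    (partial i g)); last exact: cdg.
  apply: cvgZ; first exact: cvg_snd.
  apply: cvgD; first exact: cvg_cst.
  by apply: cvgZr_tmp; exact: cvg_fst.
have [M HM] := bounded_segment2 cF.
have E : (fun h : R => h^-1 *: ((raymean k g \o shift x) (h *: e) - raymean k g x))
  = (fun h : R => h^-1 *: ((fun s : R => \int[mu]_(t in `[0, 1]) f s t) (h + 0)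
        - \int[mu]_(t in `[0, 1]) f 0 t)).
  apply/funext => h; rewrite /f addr0 scale0r addr0 /= [_ + x]addrC.
  by rewrite /raymean.
have Ia : `]-1, 1[%classic (0 : R) by rewrite /= in_itv/= ltrN10 ltr01.
have intf (s : R) : `]-1, 1[%classic s -> mu.-integrable `[0, 1] (EFin \o f s).
  by move=> _; apply/continuous_integrable01/ray_continuous.
have derf (s t : R) : `]-1, 1[%classic s -> `[0, 1]%classic t ->
  derivable (f^~ t) s 1 by move=> _ _; have [] := df s t.
have intM : mu.-integrable `[0, 1] (EFin \o cst `|M|).
  by apply: continuous_integrable01; exact: cst_continuous.
have leM (s t : R) : `]-1, 1[%classic s -> `[0, 1]%classic t ->
    `|partial1of2 f s t| <= cst `|M| t.
  move=> s1 t01; rewrite partial1of2E (@derive_val _ _ _ _ _ _ _ (df s t)).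
  apply: le_trans (ler_norm _); apply: HM => //.
  exact: subset_itv_oo_cc.
have := @cvg_differentiation_under_integral R _ _ mu f `[0, 1]
  (measurable_itv _) 0 (-1) 1 Ia intf derf _ (fun=> normr_ge0 M) intM leM.
have -> : \int[mu]_(t in `[0, 1]) partial1of2 f 0 t
    = raymean k.+1 (partial i g) x.
  apply: eq_Rintegral => t _; rewrite partial1of2E.
  by rewrite (@derive_val _ _ _ _ _ _ _ (df 0 t)) /F/= scale0r addr0.
rewrite -E => D; apply: DeriveDef; first by apply/cvg_ex; eexists; exact: D.
exact: cvg_lim D.
Qed.

(** One order of differentiability is lost, because exchanging a partial
    derivative with the mean uses that this derivative is continuous; for
    smooth functions the loss is harmless. *)
Lemma raymean_Ck m k g : Ck m.+1 g -> Ck m (raymean k g).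
Proof.
elim: m k g => [|m IH] k g /CkS[g1 dg].
  apply: C1Ck; split=> [|i x].
    exact: raymean_continuous (@C1_continuous _ _ _ g1).
  by have [] := raymean_is_derive k x g1 (@C1_continuous _ _ _ (Ck0 (dg i))).
apply/CkS; split=> [|i].
  by apply: Ck0 (IH k g _); apply/CkW/CkS.
have -> : partial i (raymean k g) = raymean k.+1 (partial i g).
  apply/funext => x; apply: derive_val.
  exact: raymean_is_derive (@C1_continuous _ _ _ (Ck0 (dg i))).
exact: IH.
Qed.

Lemma continuous_big_sum (T : topologicalType) (I : Type) (s : seq I)
    (F : I -> T -> R) :
  (forall j, continuous (F j)) -> continuous (fun t => \sum_(j <- s) F j t).
Proof.
move=> cF; elim: s => [|j s IH] t.
  by under eq_fun do rewrite big_nil; exact: cvg_cst.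
under eq_fun do rewrite big_cons.
by apply: cvgD; [exact: cF|exact: IH].
Qed.

Lemma Rintegral01_sum (I : Type) (s : seq I) (F : I -> R -> R) :
  (forall j, continuous (F j)) ->
  \int[mu]_(t in `[0, 1]) (\sum_(j <- s) F j t)
    = \sum_(j <- s) \int[mu]_(t in `[0, 1]) F j t.
Proof.
move=> cF; elim: s => [|j s IH].
  rewrite big_nil -[RHS](mul0r (fine (mu `[0%R, 1%R]%classic))) -Rintegral_cst//.
  by apply: eq_Rintegral => t _; rewrite big_nil.
rewrite big_cons -IH -RintegralD//.
- by apply: eq_Rintegral => t _; rewrite big_cons.
- exact: continuous_integrable01.
- exact/continuous_integrable01/continuous_big_sum.
Qed.

(** The fundamental theorem of calculus for [t * g (t *: x)] on [0, 1]: the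
    left-hand side is the mean of its derivative.  It says that
    [raymean 0] is a right inverse of 1 plus the Euler field. *)
Lemma raymean_euler g x : Ck 1 g ->
  \sum_i x 0 i * raymean 1 (partial i g) x + raymean 0 g x = g x.
Proof.
move=> g1; have cg := @C1_continuous _ _ _ (Ck0 g1).
have cd i : continuous (partial i g).
  by have [_ /(_ i)/Ck0/(@C1_continuous _ _ _)] := (CkS _ _).1 g1.
pose f t := g (t *: x) + t * \sum_i x 0 i * partial i g (t *: x).
have df (t : R) : is_derive t 1 (fun t : R => t * g (t *: x)) (f t).
  have -> : f t = t *: (\sum_i x 0 i * partial i g (t *: x)) + g (t *: x) *: 1.
    by rewrite /f /GRing.scale/= mulr1 addrC.
  exact: is_deriveM (is_derive_id t 1) (Ck1_is_derive_ray x t g1).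
have cray k i : continuous (fun t : R => x 0 i * (t ^+ k * partial i g (t *: x))).
  by move=> t; apply: cvgMr; exact: ray_continuous.
have fE : f = (fun t => t ^+ 0 * g (t *: x) +
    \sum_i x 0 i * (t ^+ 1 * partial i g (t *: x))).
  apply/funext => t; rewrite /f mul1r mulr_sumr; congr (_ + _).
  by apply: eq_bigr => i _; rewrite mulrCA.
have cs : continuous (fun t : R =>
    \sum_i x 0 i * (t ^+ 1 * partial i g (t *: x))).
  exact: continuous_big_sum (cray 1).
have cf : continuous f.
  by rewrite fE => t; apply: cvgD; [exact: ray_continuous|exact: cs].
have cG : continuous (fun t : R => t * g (t *: x)).
  by move=> t; apply: cvgM; [exact: cvg_id|exact: continuous_ray].
have LR : derivable_oo_LRcontinuous (fun t : R => t * g (t *: x)) 0 1.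
  split=> [t _||]; first by have [] := df t.
    by apply: cvg_at_right_filter; exact: cG.
  by apply: cvg_at_left_filter; exact: cG.
have G'f : {in `]0, 1[, derive1 (fun t : R => t * g (t *: x)) =1 f}.
  by move=> t _; rewrite derive1E; have [] := df t.
have := continuous_FTC2 ltr01 (continuous_subspaceT cf) LR G'f.
move=> /(congr1 fine); rewrite mul0r sube0 mul1r scale1r /= => <-.
rewrite -[RHS]/(\int[mu]_(t in `[0, 1]) f t) fE RintegralD//; last 2 first.
- exact/continuous_integrable01/ray_continuous.
- exact: continuous_integrable01.
rewrite addrC; congr (_ + _).
rewrite (Rintegral01_sum _ (cray 1%N)); apply: eq_bigr => i _.
by rewrite RintegralZl//; apply/continuous_integrable01/ray_continuous.
Qed.

End RayMeans.

(** * The Euler field on smooth functions *)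

Section SmoothCalculus.
Variables (R : realType) (n : nat).
Local Notation C := (Cinf R n).
Implicit Types (f g : C) (V W : Vect R n) (i j : 'I_n).

Lemma Cinf_Ck k f : Ck k f.
Proof. exact: (smoothCk _).1 (Cinf_smooth f) k. Qed.

Lemma Cinf_sumE (I : Type) (s : seq I) (F : I -> C) x :
  (\sum_(k <- s) F k) x = \sum_(k <- s) F k x.
Proof. by elim/big_rec2: _ => [//|k u v _ <-]. Qed.

Lemma pdC i j f : pd i (pd j f) = pd j (pd i f).
Proof.
apply: Cinf_inj => x.
exact: (congr1 (@^~ x) (Ck2_partialC i j (@Cinf_Ck 2 f))).
Qed.

Lemma vapp_bracket V W f :
  vapp (bracket V W) f = vapp V (vapp W f) - vapp W (vapp V f).
Proof.
have vappA U U' : vapp U (vapp U' f) =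
    \sum_j pd j f * vapp U (U' 0 j) + \sum_j \sum_i U 0 i * U' 0 j * pd i (pd j f).
  rewrite {2}/vapp linear_sum -big_split; apply: eq_bigr => j _ /=.
  rewrite vappM addrC; congr (_ + _); rewrite /vapp mulr_sumr.
  by apply: eq_bigr => i _; rewrite mulrCA mulrA.
have sym : \sum_j \sum_i V 0 i * W 0 j * pd i (pd j f)
    = \sum_j \sum_i W 0 i * V 0 j * pd i (pd j f).
  rewrite exchange_big; apply: eq_bigr => j _; apply: eq_bigr => i _ /=.
  by rewrite pdC [V 0 j * _]mulrC.
rewrite !vappA sym opprD addrACA subrr addr0 -sumrB {1}/vapp.
by apply: eq_bigr => j _; rewrite mxE mulrC mulrBr.
Qed.

Definition Cinf_raymean k f : C :=
  MkCinf ((smoothCk _).2 (fun m => @raymean_Ck R n m k f (@Cinf_Ck m.+1 f))).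

Lemma pd_raymean k i f : pd i (Cinf_raymean k f) = Cinf_raymean k.+1 (pd i f).
Proof.
apply: Cinf_inj => x.
have [] := @raymean_is_derive R n k i f x (Ck0 (@Cinf_Ck 0 f))
  (@C1_continuous _ _ _ (Ck0 (@Cinf_Ck 0 (pd i f)))).
by [].
Qed.

Definition radial : Vect R n := \row_j Defs.coord R j.

Lemma radialE f x : vapp radial f x = \sum_i x 0 i * pd i f x.
Proof. by rewrite /vapp Cinf_sumE; apply: eq_bigr => i _; rewrite CinfM mxE. Qed.

Lemma radial_coord i : vapp radial (Defs.coord R i) = Defs.coord R i.
Proof.
rewrite /vapp (bigD1 i)//= pd_coord eqxx mulr1 mxE big1 ?addr0// => j ji.
by rewrite pd_coord (negbTE ji) mulr0.
Qed.

Lemma radial_raymean f :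
  vapp radial (Cinf_raymean 0 f) + Cinf_raymean 0 f = f.
Proof.
apply: Cinf_inj => x; rewrite CinfD radialE.
under eq_bigr do rewrite pd_raymean.
exact: raymean_euler (@Cinf_Ck 1 f).
Qed.

(** Along the ray through [x], the derivative of [f] at parameter [c] is
    [c^-1] times [vapp radial f] at [c *: x], hence zero. *)
Lemma radial_eq0 f : vapp radial f = 0 -> f = (f 0)%:A.
Proof.
move=> Lf; apply: Cinf_inj => x; rewrite CinfZ Cinf1 mulr1.
have df t := Ck1_is_derive_ray x t (@Cinf_Ck 1 f).
have [|c c01] := MVT ltr01 (fun t _ => df t).
  apply: continuous_subspaceT; apply: continuous_ray.
  exact: @C1_continuous _ _ _ (Ck0 (@Cinf_Ck 0 f)).
rewrite scale1r scale0r subr0 mulr1 => /eqP; rewrite subr_eq => /eqP ->.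
suff -> : \sum_i x 0 i * partial i f (c *: x) = 0 by rewrite add0r.
have c0 : c != 0 by move: c01; rewrite in_itv/= => /andP[/lt0r_neq0].
apply: (mulfI c0); rewrite mulr0 mulr_sumr.
transitivity (vapp radial f (c *: x)); last by rewrite Lf.
rewrite radialE.
by apply: eq_bigr => i _; rewrite mxE mulrA.
Qed.

(** Both sides vanish at the origin and have the same image [vapp radial f] under
    the Euler field, so they agree by [radial_eq0]. *)
Lemma hadamard f :
  \sum_i Defs.coord R i * Cinf_raymean 0 (pd i f) = f - (f 0)%:A.
Proof.
set h := LHS.
have Lh : vapp radial (h - f) = 0.
  rewrite linearB /h linear_sum /=; apply/eqP; rewrite subr_eq0; apply/eqP.
  apply: eq_bigr => i _; rewrite vappM radial_coord mulrC -mulrDl mxE.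
  by rewrite radial_raymean mulrC.
have := radial_eq0 Lh; rewrite CinfD CinfN.
have -> : h 0 = 0.
  by rewrite /h Cinf_sumE big1// => i _; rewrite CinfM [X in X * _]mxE mul0r.
by rewrite sub0r scaleNr => /eqP; rewrite subr_eq addrC => /eqP.
Qed.

(** Since [vapp radial (x_i h) = x_i (h + vapp radial h)], applying the Euler
    field to the witness cancels one of the two means and leaves Hadamard's
    expansion of [f]. *)
Lemma radial_surj f : f 0 = 0 -> exists g, vapp radial g = f.
Proof.
move=> f0; exists (\sum_i Defs.coord R i * Cinf_raymean 0 (Cinf_raymean 0 (pd i f))).
rewrite linear_sum -[RHS]subr0 -[X in _ - X](scale0r 1) -f0 -hadamard.
apply: eq_bigr => i _ /=; rewrite vappM radial_coord.
by rewrite [X in _ + X]mulrC -mulrDr radial_raymean.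
Qed.

Lemma vapp_vanish V f x :
  (forall j, V 0 j x = 0) -> vapp V f x = 0.
Proof.
by move=> Vx; rewrite /vapp Cinf_sumE big1// => j _; rewrite CinfM Vx mul0r.
Qed.

Lemma vapp_cst V (c : R) : vapp V c%:A = 0.
Proof.
have /eqP := vappM V 1 1; rewrite !mul1r -subr_eq0 opprD addNKr oppr_eq0.
by rewrite linearZ => /eqP /= ->; rewrite scaler0.
Qed.

(** A module generated by two commuting fields is involutive; this is the
    bracket in coordinates. *)
Lemma bracket_comb V W (a b c d : C) :
  bracket V W = 0 ->
  bracket (a *: V + b *: W) (c *: V + d *: W) =
    (vapp (a *: V + b *: W) c - vapp (c *: V + d *: W) a) *: V +
    (vapp (a *: V + b *: W) d - vapp (c *: V + d *: W) b) *: W.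
Proof.
move=> VW; set X := a *: V + _; set Y := c *: V + _.
have XE f : vapp X f = a * vapp V f + b * vapp W f := vapp_comb a b V W f.
have YE f : vapp Y f = c * vapp V f + d * vapp W f := vapp_comb c d V W f.
apply/rowP => j.
have Xj : X 0 j = a * V 0 j + b * W 0 j by rewrite !mxE.
have Yj : Y 0 j = c * V 0 j + d * W 0 j by rewrite !mxE.
have -> : bracket X Y 0 j = vapp X (Y 0 j) - vapp Y (X 0 j) by rewrite mxE.
rewrite Xj Yj (linearD (vapp X)) (linearD (vapp Y)) /= !vappM.
rewrite (XE (V 0 j)) (XE (W 0 j)) (YE (V 0 j)) (YE (W 0 j)) 3!mxE.
have -> : vapp V (W 0 j) = vapp W (V 0 j).
  apply/eqP; rewrite -subr_eq0.
  by have /rowP/(_ j) := VW; rewrite !mxE => ->.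
ring.
Qed.

End SmoothCalculus.

(** * The frame of E *)

Section Frame.
Variable R : realType.
Local Notation C := (Cinf R 2).
Local Notation E := (E12 R).
Local Notation S := (Esection E).
Implicit Types (f g : C) (u w : S).

Local Notation L1 := (vapp (v1 R)).
Local Notation L2 := (vapp (v2 R)).

Lemma v1_radial : v1 R = radial R 2.
Proof.
apply/rowP => j; rewrite !mxE; case: j => -[|[|//]] j2 /=;
  congr (Defs.coord R _); exact: val_inj.
Qed.

Lemma L1_origin f : L1 f 0 = 0.
Proof.
by apply: vapp_vanish => j; rewrite v1_radial mxE [LHS]mxE.
Qed.

Lemma L2_origin f : L2 f 0 = 0.
Proof.
apply: vapp_vanish => -[[|[|//]] j2]; rewrite mxE /=.
  by rewrite -[LHS]/(- ((0 : 'rV[R]_2) 0 1)) mxE oppr0.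
by rewrite [LHS]mxE.
Qed.

Lemma bracket_v12 : bracket (v1 R) (v2 R) = 0.
Proof.
apply/rowP => j; rewrite mxE [RHS]mxE v1_radial.
have L2x : L2 (Defs.coord R 0) = - Defs.coord R 1.
  rewrite /vapp !big_ord_recl big_ord0 !mxE /= !pd_coord /=; ring.
have L2y : L2 (Defs.coord R 1) = Defs.coord R 0.
  rewrite /vapp !big_ord_recl big_ord0 !mxE /= !pd_coord /=; ring.
apply/eqP; rewrite subr_eq0; apply/eqP; rewrite !mxE.
case: j => -[|[|//]] j2 /=.
  rewrite linearN /= radial_coord -L2x; congr (L2 (Defs.coord R _)).
  exact: val_inj.
rewrite radial_coord -{1}L2y; congr (L2 (Defs.coord R _)).
exact: val_inj.
Qed.

Lemma L12C f : L1 (L2 f) = L2 (L1 f).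
Proof.
apply/eqP; rewrite -subr_eq0 -vapp_bracket bracket_v12.
by rewrite /vapp big1// => i _; rewrite mxE mul0r.
Qed.

Lemma Cinf_eq_off_origin f g : (forall x, x != 0 -> f x = g x) -> f = g.
Proof.
move=> fg; apply/eqP; rewrite -subr_eq0; apply/eqP; set h := f - g.
have h0 x : x != 0 -> h x = 0.
  by move=> /fg e; rewrite CinfD CinfN e subrr.
apply: Cinf_inj => x; rewrite Cinf0; have [->|/h0//] := eqVneq x 0.
pose v : 'rV[R]_2 := const_mx 1.
have cray := @continuous_ray R 2 h v (@C1_continuous _ _ _ (smoothC1 (Cinf_smooth h))).
have := cray 0; rewrite /continuous_at scale0r => ch.
apply: (@cvg_unique _ (@Rhausdorff R) ((fun t : R => h (t *: v)) @ 0^')).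
  exact: cvg_trans (cvg_app _ (@nbhs_dnbhs _ (0 : R))) ch.
apply: cvg_near_cst; near=> t.
apply: h0; apply/eqP => /rowP/(_ 0); rewrite !mxE mulr1 => t0.
have : t != 0 by near: t; exact: nbhs_dnbhs_neq.
by rewrite t0 eqxx.
Unshelve. all: by end_near. Qed.

(** The determinant of the frame [v1], [v2] is the squared norm, which is
    invertible off the origin only; continuity takes care of the origin. *)
Lemma mul_sqnorm_inj f g (x := Defs.coord R 0) (y := Defs.coord R 1) :
  f * (x * x + y * y) = g * (x * x + y * y) -> f = g.
Proof.
move=> fg; apply: Cinf_eq_off_origin => z z0.
pose s : R := z 0 0; pose t : R := z 0 1.
have nz : s * s + t * t != 0.
  apply: contraNneq z0 => st0; have [s0 t0] : s = 0 /\ t = 0 by split; nra.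
  apply/eqP/rowP => -[[|[|//]] j2]; rewrite mxE; [rewrite -s0|rewrite -t0];
    by congr (z 0 _); exact: val_inj.
exact: (mulIf nz (congr1 (fun h : C => h z) fg)).
Qed.

Lemma v12_free (a b c d : C) :
  a *: v1 R + b *: v2 R = c *: v1 R + d *: v2 R -> a = c /\ b = d.
Proof.
move=> /rowP ab; have := ab 0; have := ab 1; rewrite !mxE /=.
set y := Defs.coord R 1; set x := Defs.coord R 0 => eq1 eq0.
split; apply: mul_sqnorm_inj; rewrite -/x -/y.
  transitivity (x * (a * x + b * - y) + y * (a * y + b * x)); first ring.
  by rewrite eq0 eq1; ring.
transitivity (x * (a * y + b * x) - y * (a * x + b * - y)); first ring.
by rewrite eq0 eq1; ring.
Qed.

Lemma frame_coordsP u :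
  exists p : C * C, (u : Vect R 2) = p.1 *: v1 R + p.2 *: v2 R.
Proof.
by have /asboolP[a [b e]] := Esection_valP u; exists (a, b).
Qed.

(** The coordinates of a section, that is, the dual frame [th1], [th2]. *)
Definition coframe1 u : C := (sval (cid (frame_coordsP u))).1.
Definition coframe2 u : C := (sval (cid (frame_coordsP u))).2.

Lemma frameE u : (u : Vect R 2) = coframe1 u *: v1 R + coframe2 u *: v2 R.
Proof. exact: svalP (cid (frame_coordsP u)). Qed.

Lemma frame_unique u (a b : C) :
  (u : Vect R 2) = a *: v1 R + b *: v2 R -> coframe1 u = a /\ coframe2 u = b.
Proof. by rewrite frameE; exact: v12_free. Qed.

Lemma frame_linear (c : C) u w :
  coframe1 (c *: u + w) = c * coframe1 u + coframe1 w /\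
  coframe2 (c *: u + w) = c * coframe2 u + coframe2 w.
Proof.
apply: frame_unique; rewrite [LHS](_ : _ = c *: (u : Vect R 2) + w)//.
by rewrite {1}[u : Vect R 2]frameE {1}[w : Vect R 2]frameE
  scalerDr !scalerDl !scalerA addrACA.
Qed.

Lemma frame_bracket u w :
  coframe1 (Ebracket u w) = vapp u (coframe1 w) - vapp w (coframe1 u) /\
  coframe2 (Ebracket u w) = vapp u (coframe2 w) - vapp w (coframe2 u).
Proof.
apply: frame_unique; rewrite /= {1}[u : Vect R 2]frameE {1}[w : Vect R 2]frameE.
by rewrite bracket_comb ?bracket_v12// -!frameE.
Qed.

Lemma vapp_frame u f : vapp u f = coframe1 u * L1 f + coframe2 u * L2 f.
Proof. by rewrite {1}[u : Vect R 2]frameE vapp_comb. Qed.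

Lemma v1_in : v1 R \in (E : submodClosed _).
Proof. by apply/asboolP; exists 1, 0; rewrite scale1r scale0r addr0. Qed.

Lemma v2_in : v2 R \in (E : submodClosed _).
Proof. by apply/asboolP; exists 0, 1; rewrite scale1r scale0r add0r. Qed.

Definition frame1 : S := MkEsection v1_in.
Definition frame2 : S := MkEsection v2_in.

Lemma coords_frame1 : (coframe1 frame1 = 1) * (coframe2 frame1 = 0).
Proof.
have [] : coframe1 frame1 = 1 /\ coframe2 frame1 = 0; last by [].
by apply: frame_unique; rewrite scale1r scale0r addr0.
Qed.

Lemma coords_frame2 : (coframe1 frame2 = 0) * (coframe2 frame2 = 1).
Proof.
have [] : coframe1 frame2 = 0 /\ coframe2 frame2 = 1; last by [].
by apply: frame_unique; rewrite scale1r scale0r add0r.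
Qed.

Lemma section_frame u : u = coframe1 u *: frame1 + coframe2 u *: frame2.
Proof. by apply: val_inj; rewrite /= {1}[u : Vect R 2]frameE. Qed.

End Frame.

(** * Quotients and the Koszul differential in low degrees *)

Section QuotientIso.
Variables (R : pzRingType) (V W : lmodType R) (I : submodClosed V).

Lemma lquot_iso (f : {linear V -> W}) :
  (forall v, v \in I <-> f v = 0) -> (forall w, exists v, f v = w) ->
  exists phi : {linear lquot I -> W}, bijective phi.
Proof.
move=> kerf surf; pose g (q : lquot I) := f (lrepr q).
have gE v : g (lclass I v) = f v.
  apply/eqP; rewrite -subr_eq0 -linearB; apply/eqP/kerf/lclassP.
  exact: lreprK.
have g_linear : linear g.
  move=> a q q'; rewrite -{1}[q]lreprK -{1}[q']lreprK.
  by rewrite -linearP gE linearP.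
pose phi := HB.pack_for {linear lquot I -> W} g
  (GRing.isLinear.Build R (lquot I) W _ g g_linear).
exists phi; have [h hP] := choice surf; exists (fun w => lclass I (h w)).
  move=> q; rewrite -[RHS]lreprK; apply/lclassP/kerf.
  by rewrite linearB hP subrr.
by move=> w; rewrite -[LHS]/(g _) gE.
Qed.

End QuotientIso.

Section Koszul.
Variables (R : realType) (n : nat) (E : Estructure R n).
Local Notation C := (Cinf R n).
Local Notation S := (Esection E).

Definition pair_fun (u v : S) : 'I_2 -> S := fun i => if i == 0 :> nat then u else v.

Lemma pair_funP (F : 'I_2 -> S) u v :
  F ord0 = u -> F (lift ord0 ord0) = v -> F = pair_fun u v.
Proof.
move=> <- <-; apply/funext => -[[|[|//]] k2]; rewrite /pair_fun /=;
  congr F; exact: val_inj.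
Qed.

Lemma Ed0E (w : ('I_0 -> S) -> C) (V : 'I_1 -> S) :
  Ed w V = vapp (V ord0) (w (fun k => V (lift ord0 k))).
Proof.
rewrite /Ed !big_ord_recl !big_ord0 big_mkcond big_ord_recl big_ord0 /=.
by rewrite expr0 mul1r !addr0.
Qed.

Lemma Ed1E (w : ('I_1 -> S) -> C) u v :
  Ed w (pair_fun u v) =
  vapp u (w (fun=> v)) - vapp v (w (fun=> u)) - w (fun=> Ebracket u v).
Proof.
rewrite /Ed; under [X in _ + X]eq_bigr do rewrite big_mkcond.
rewrite !big_ord_recl !big_ord0 /= !expr0 !expr1 !mul1r !mulN1r !addr0 add0r.
have one F (x : S) : F ord0 = x -> F = (fun _ : 'I_1 => x).
  by move=> <-; apply/funext => k; rewrite [k]ord1.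
by rewrite !(one (fun k => _) _ erefl).
Qed.

Lemma Ed2E (w : ('I_2 -> S) -> C) (V : 'I_3 -> S) (v := fun k => V (inord k)) :
  Ed w V =
  vapp (v 0) (w (pair_fun (v 1) (v 2))) -
  vapp (v 1) (w (pair_fun (v 0) (v 2))) +
  vapp (v 2) (w (pair_fun (v 0) (v 1))) -
  w (pair_fun (Ebracket (v 0) (v 1)) (v 2)) +
  w (pair_fun (Ebracket (v 0) (v 2)) (v 1)) -
  w (pair_fun (Ebracket (v 1) (v 2)) (v 0)).
Proof.
have vE (i : 'I_3) (m : nat) : val i = m -> V i = v m.
  by move=> <-; rewrite /v inord_val.
have liftE (i : 'I_3) : w (fun k => V (lift i k))
    = w (pair_fun (v (bump i 0)) (v (bump i 1))).
  by congr w; apply: pair_funP; apply: vE.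
have bracketE (i j : 'I_3) : w (fun k => if k == 0%N :> nat then Ebracket (V i) (V j)
      else V (inord (bump j (bump i k.-1))))
    = w (pair_fun (Ebracket (v i) (v j)) (v (bump j (bump i 0)))).
  by congr w; apply: pair_funP; rewrite //= !(vE _ _ erefl).
rewrite /Ed; under eq_bigr do rewrite liftE (vE _ _ erefl).
under [X in _ + X]eq_bigr do
  (rewrite big_mkcond; under eq_bigr do rewrite bracketE).
rewrite !big_ord_recl !big_ord0 /= /bump /= !(addn0, add0n, add1n).
rewrite [_ ^+ 3]exprS sqrrN !(expr0, expr1, expr1n) mulr1.
by rewrite !mul1r !mulN1r !addr0 !add0r !addrA.
Qed.

End Koszul.

(** * Forms and their cohomology *)

Section Cohomology.
Variables (R : realType) (n : nat) (E : Estructure R n).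
Local Notation C := (Cinf R n).
Local Notation S := (Esection E).

Lemma form_multilinear p (w : Eform E p) : multilinear w.
Proof. by have /asboolP[] := Eform_valP w. Qed.

Lemma form_alternating p (w : Eform E p) : Defs.alternating w.
Proof. by have /asboolP[] := Eform_valP w. Qed.

Lemma Eclosed_Ed p (w : Eclosed E p) V : Ed w V = 0.
Proof. by have /asboolP := Eclosed_valP w; apply. Qed.

Lemma Ed_zero p : @Ed R n E p 0 = 0.
Proof.
by have := Ed_linear (-1) (0 : ('I_p -> S) -> C) 0;
  rewrite scaler0 addr0 scaleN1r addNr.
Qed.

Lemma upd_id p (V : 'I_p -> S) k : upd V k (V k) = V.
Proof. by apply/funext => j; rewrite /upd; case: eqP => [->|]. Qed.

Lemma multilinear_section0 p (w : ('I_p -> S) -> C) V k :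
  multilinear w -> w (upd V k 0) = 0.
Proof.
move=> mw; have := mw V k (-1) 0 0.
by rewrite scaler0 addr0 mulN1r addNr.
Qed.

Lemma multilinear_comb p (w : ('I_p -> S) -> C) V k (a b : C) u v :
  multilinear w ->
  w (upd V k (a *: u + b *: v)) = a * w (upd V k u) + b * w (upd V k v).
Proof.
move=> mw; rewrite mw; congr (_ + _).
by rewrite -[b *: v]addr0 mw multilinear_section0// addr0.
Qed.

(** All the isomorphisms below are of this form: the coordinates of a class are
    the values at the origin of finitely many coefficients of a closed form. *)
Lemma cohomology_iso p m (arg : 'I_m -> 'I_p -> S) :
  (forall w : Eclosed E p, exact_form w <-> forall j, w (arg j) 0 = 0) ->
  (forall r : 'I_m -> R, exists w : ('I_p -> S) -> C,
     [/\ multilinear w, Defs.alternating w, (forall V, Ed w V = 0) &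
         forall j, w (arg j) 0 = r j]) ->
  exists phi : {linear Ecohomology E p -> 'rV[R]_m}, bijective phi.
Proof.
move=> exactE surj.
pose ev (w : Eclosed E p) : 'rV[R]_m := \row_j w (arg j) 0.
have ev_linear : linear ev.
  by move=> a w w'; apply/rowP => j; rewrite !mxE.
pose evL := HB.pack_for {linear Eclosed E p -> 'rV[R]_m} ev
  (GRing.isLinear.Build R (Eclosed E p) 'rV[R]_m _ ev ev_linear).
apply: (@lquot_iso _ _ _ _ evL) => [w|r].
  split=> [/asboolP/exactE w0|/rowP w0].
    by apply/rowP => j; rewrite !mxE.
  by apply/asboolP/exactE => j; have := w0 j; rewrite !mxE.
have [w [mw aw cw wr]] := surj (r 0).
have wF : w \in @form_pred R n E p by apply/asboolP.
have wC : MkEform wF \in @closed_pred R n E p by apply/asboolP.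
by exists (MkEclosed wC); apply/rowP => j; rewrite mxE.
Qed.

End Cohomology.

Section E12Cohomology.
Variable R : realType.
Local Notation C := (Cinf R 2).
Local Notation E := (E12 R).
Local Notation S := (Esection E).
Local Notation L1 := (vapp (v1 R)).
Local Notation L2 := (vapp (v2 R)).
Implicit Types (f g : C) (u v : S).

(** The 2-form [th1 /\ th2]. *)
Definition area (V : 'I_2 -> S) : C :=
  coframe1 (V 0) * coframe2 (V 1) - coframe1 (V 1) * coframe2 (V 0).

Lemma multilinear_frame p (w : ('I_p -> S) -> C) V k : multilinear w ->
  w V = coframe1 (V k) * w (upd V k (frame1 R))
    + coframe2 (V k) * w (upd V k (frame2 R)).
Proof.
move=> mw; rewrite -{1}[V](upd_id V k) {1}[V k]section_frame.
exact: multilinear_comb.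
Qed.

Lemma one_form_frame (w : ('I_1 -> S) -> C) V : multilinear w ->
  w V = coframe1 (V 0) * w (fun=> frame1 R)
    + coframe2 (V 0) * w (fun=> frame2 R).
Proof.
move=> mw; rewrite (multilinear_frame V 0 mw).
by congr (_ * w _ + _ * w _); apply/funext => k; rewrite /upd [k]ord1 eqxx.
Qed.

Lemma two_form_frame (w : ('I_2 -> S) -> C) V :
  multilinear w -> Defs.alternating w ->
  w V = area V * w (pair_fun (frame1 R) (frame2 R)).
Proof.
move=> mw aw.
have updE (a b : S) : upd (upd V 0 a) 1 b = pair_fun a b.
  exact: pair_funP.
have updL (a b : S) : upd (pair_fun b b) 0 a = pair_fun a b by exact: pair_funP.
have updR (a b : S) : upd (pair_fun a a) 1 b = pair_fun a b by exact: pair_funP.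
have diag u : w (pair_fun u u) = 0 by exact: (aw _ 0 1).
have swap : w (pair_fun (frame2 R) (frame1 R)) = - w (pair_fun (frame1 R) (frame2 R)).
  (* Polarization: expand the value on the repeated section s. *)
  pose s : S := 1 *: frame1 R + 1 *: frame2 R.
  have addL z : w (pair_fun s z) = w (pair_fun (frame1 R) z) + w (pair_fun (frame2 R) z).
    by rewrite -(updL s z) multilinear_comb// !updL !mul1r.
  have addR z : w (pair_fun z s) = w (pair_fun z (frame1 R)) + w (pair_fun z (frame2 R)).
    by rewrite -(updR z s) multilinear_comb// !updR !mul1r.
  have := diag s; rewrite addL !addR !diag add0r addr0 addrC => /eqP.
  by rewrite addr_eq0 => /eqP.
rewrite (multilinear_frame V 0 mw) !(multilinear_frame (upd V 0 _) 1 mw) !updE.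
by rewrite !diag swap /area /upd /=; ring.
Qed.

(** Expanding three arguments in the frame, each of the resulting terms repeats
    one of the two frame sections. *)
Lemma form_eq0_of_three p (w : ('I_p -> S) -> C) (i j k : 'I_p) :
  i != j -> i != k -> j != k -> multilinear w -> Defs.alternating w ->
  forall V, w V = 0.
Proof.
move=> ij ik jk mw aw V.
have vanish a b c : [\/ a = b, a = c | b = c] ->
    w (upd (upd (upd V i a) j b) k c) = 0.
  case=> [ab|ac|bc].
  - by apply: (aw _ i j ij); rewrite /upd !eqxx (negbTE ij) (negbTE ik) (negbTE jk).
  - by apply: (aw _ i k ik); rewrite /upd !eqxx (negbTE ij) (negbTE ik).
  - by apply: (aw _ j k jk); rewrite /upd !eqxx (negbTE jk).
rewrite (multilinear_frame V i mw) !(multilinear_frame (upd V i _) j mw).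
rewrite !(multilinear_frame (upd (upd V i _) j _) k mw).
by rewrite !vanish ?(mulr0, addr0)//;
  (by constructor 1) || (by constructor 2) || by constructor 3.
Qed.

Lemma cohomology0 :
  exists phi : {linear Ecohomology E 0 -> 'rV[R]_1}, bijective phi.
Proof.
apply: (cohomology_iso (arg := fun _ _ => 0)) => [w|r].
  split=> [w0 j|w0].
    by rewrite [X in Eform_val X](w0 : Eclosed_val w = 0).
  apply: val_inj; apply/funext => V /=.
  have L1w : L1 (w V) = 0.
    have := Eclosed_Ed w (fun=> frame1 R).
    rewrite Ed0E /=; congr (L1 (w _) = _).
    by apply/funext => -[].
  rewrite v1_radial in L1w; rewrite [LHS](radial_eq0 L1w).
  have -> : V = fun=> 0 by apply/funext => -[].
  by rewrite (w0 0) scale0r.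
exists (fun=> (r 0)%:A); split.
- by move=> V [].
- by move=> V [].
- by move=> V; rewrite Ed0E; exact: vapp_cst.
- by move=> j; rewrite [j]ord1 CinfZ Cinf1 mulr1.
Qed.

(** In the dual frame, [d (a th1 + b th2) = (L1 b - L2 a) th1 /\ th2], because
    [th1] and [th2] are closed: the bracket of u and v has coordinates
    [u (th1 v) - v (th1 u)] and [u (th2 v) - v (th2 u)]. *)
Lemma Ed_one_form (w : ('I_1 -> S) -> C) : multilinear w -> forall V,
  Ed w V = (L1 (w (fun=> frame2 R)) - L2 (w (fun=> frame1 R))) * area V.
Proof.
move=> mw V.
have -> : V = pair_fun (V 0) (V 1)
  by apply: pair_funP; congr V; exact: val_inj.
move: (V 0) (V 1) => u v.
set a := w (fun=> frame1 R); set b := w (fun=> frame2 R).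
have wE x : w (fun=> x) = coframe1 x * a + coframe2 x * b := one_form_frame (fun=> x) mw.
have [abr bbr] := frame_bracket u v.
rewrite Ed1E (wE u) (wE v) (wE (Ebracket u v)) abr bbr /area /=.
rewrite (linearD (vapp u)) (linearD (vapp v)) /= !vappM.
rewrite (vapp_frame u a) (vapp_frame u b) (vapp_frame v a) (vapp_frame v b).
ring.
Qed.

Lemma Ed_area V : Ed area V = 0.
Proof.
rewrite Ed2E.
move: (V (inord 0)) (V (inord 1)) (V (inord 2)) => a b c.
rewrite /area /=.
have [-> ->] := frame_bracket a b.
have [-> ->] := frame_bracket a c.
have [-> ->] := frame_bracket b c.
rewrite ![vapp _ (_ - _)]linearB /= !vappM; ring.
Qed.

Lemma cohomology1 :
  exists phi : {linear Ecohomology E 1 -> 'rV[R]_2}, bijective phi.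
Proof.
apply: (cohomology_iso
  (arg := fun j _ => if j == 0 :> nat then frame1 R else frame2 R)) => [w|r].
  split=> [[f wE] j|w0].
    rewrite wE Ed0E; case: ifP => _; [exact: L1_origin|exact: L2_origin].
  have mw := form_multilinear w.
  set a := w (fun=> frame1 R); set b := w (fun=> frame2 R).
  have a0 : a 0 = 0 := w0 0.
  have b0 : b 0 = 0 := w0 1.
  have L12 : L1 b = L2 a.
    have := Eclosed_Ed w (pair_fun (frame1 R) (frame2 R)); rewrite (Ed_one_form mw).
    rewrite /area /= !(coords_frame1 R) !(coords_frame2 R) mulr1 mulr0 subr0 mulr1.
    by move/eqP; rewrite subr_eq0 => /eqP.
  have [f fE] := radial_surj a0; rewrite -v1_radial in fE.
  have L2f : L2 f = b.
    have : vapp (radial R 2) (L2 f - b) = 0.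
      by rewrite -v1_radial linearB /= L12C fE L12 subrr.
    move=> /radial_eq0; rewrite CinfD CinfN L2_origin b0 subr0 scale0r.
    by move/eqP; rewrite subr_eq0 => /eqP.
  have fF : (fun=> f) \in @form_pred R 2 E 0.
    by apply/asboolP; split=> V [].
  exists (MkEform fF); apply/funext => V.
  by rewrite Ed0E vapp_frame fE L2f; exact: one_form_frame.
pose w (V : 'I_1 -> S) := r 0 *: coframe1 (V 0) + r 1 *: coframe2 (V 0).
have mw : multilinear w.
  move=> V k c u v; rewrite [k]ord1 /w /upd !eqxx.
  have [-> ->] := frame_linear c u v.
  by rewrite !scalerDr !scalerAr mulrDr addrACA.
have w1 : w (fun=> frame1 R) = (r 0)%:A.
  by rewrite /w (coords_frame1 R).1 (coords_frame1 R).2 scaler0 addr0.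
have w2 : w (fun=> frame2 R) = (r 1)%:A.
  by rewrite /w (coords_frame2 R).1 (coords_frame2 R).2 scaler0 add0r.
exists w; split => //.
- by move=> V i j; rewrite [i]ord1 [j]ord1 eqxx.
- by move=> V; rewrite (Ed_one_form mw) w1 w2 !vapp_cst subrr mul0r.
- move=> -[[|[|//]] j2].
    transitivity (w (fun=> frame1 R) 0) => //.
    by rewrite w1 CinfZ Cinf1 mulr1; congr r; exact: val_inj.
  transitivity (w (fun=> frame2 R) 0) => //.
  by rewrite w2 CinfZ Cinf1 mulr1; congr r; exact: val_inj.
Qed.

Lemma area_form : area \in @form_pred R 2 E 2.
Proof.
apply/asboolP; split=> [V k c u v|V i j].
  have [al bl] := frame_linear c u v.
  case: k => -[|[|//]] k2; rewrite /area /upd /= al bl; ring.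
have V01 (k : 'I_2) : V k = if k == 0 :> nat then V 0 else V 1.
  by case: k => -[|[|//]] k2; congr V; exact: val_inj.
rewrite (V01 i) (V01 j) /area.
by case: i j => -[|[|//]] i2 [[|[|//]] j2] //= _ => [->|<-]; rewrite subrr.
Qed.

Lemma cohomology2 :
  exists phi : {linear Ecohomology E 2 -> 'rV[R]_1}, bijective phi.
Proof.
apply: (cohomology_iso (arg := fun _ => pair_fun (frame1 R) (frame2 R))) => [w|r].
  split=> [[g wE] j|w0].
    rewrite wE (Ed_one_form (form_multilinear g)).
    by rewrite CinfM CinfD CinfN L1_origin L2_origin subr0 mul0r.
  have [b bE] := radial_surj (w0 0); rewrite -v1_radial in bE.
  pose g (V : 'I_1 -> S) := b * coframe2 (V 0).
  have mg : multilinear g.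
    move=> V k c u v; rewrite [k]ord1 /g /upd !eqxx (frame_linear c u v).2.
    by rewrite mulrDr mulrCA.
  have gF : g \in @form_pred R 2 E 1.
    apply/asboolP; split=> // V i j.
    by rewrite [i]ord1 [j]ord1 eqxx.
  exists (MkEform gF); apply/funext => V; rewrite (Ed_one_form mg) /g.
  rewrite (coords_frame1 R).2 (coords_frame2 R).2 mulr1 mulr0 linear0 subr0 bE mulrC.
  exact: two_form_frame (form_multilinear w) (@form_alternating _ _ _ _ w).
have /asboolP[ma aa] : r 0 *: area \in @form_pred R 2 E 2.
  by rewrite rpredZ// area_form.
exists (r 0 *: area); split => // [V|j].
  have := Ed_linear (r 0) area 0; rewrite Ed_zero !addr0 => ->.
  by rewrite -[LHS]/(r 0 *: Ed area V) Ed_area scaler0.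
rewrite [j]ord1 -[LHS]/(r 0 * area _ 0) /area /=.
rewrite !(coords_frame1 R) !(coords_frame2 R).
by rewrite mulr1 mulr0 subr0 Cinf1 mulr1.
Qed.

Lemma cohomology_ge3 p :
  exists phi : {linear Ecohomology E p.+3 -> 'rV[R]_0}, bijective phi.
Proof.
apply: (cohomology_iso (arg := fun _ _ => 0)) => [w|r].
  split=> [_ []//|_]; exists 0; apply/funext => V.
  rewrite [RHS](congr1 (@^~ V) (Ed_zero E p.+2)).
  apply: (@form_eq0_of_three p.+3 w ord0 (inord 1) (inord 2)).
  - by rewrite -val_eqE /= inordK.
  - by rewrite -val_eqE /= inordK.
  - by rewrite -val_eqE /= !inordK.
  - exact: form_multilinear.
  - exact: (@form_alternating _ _ _ _ w).
exists (fun=> 0); split => //.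
- by move=> V k c u v; rewrite mulr0 addr0.
- by move=> V; exact: (congr1 (@^~ V) (Ed_zero E p.+3)).
- by move=> [].
Qed.

End E12Cohomology.

Theorem theorem34 (R : realType) (k : nat) :
  exists phi : {linear Ecohomology (E12 R) k ->
                  'rV[R]_(match k with
                          | 0 => 1
                          | 1 => 2
                          | 2 => 1
                          | _ => 0
                          end)},
    bijective phi.
Proof.
case: k => [|[|[|k]]].
- exact: cohomology0.
- exact: cohomology1.
- exact: cohomology2.
- exact: cohomology_ge3.
Qed.
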